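(* Let $p\in\{2,3\}$ and let $A=(a_1,a_2,a_3)$ with $\gcd(a_1,a_2,a_3)=1$, where $a_i=pk_i+t_i$ with $k_i\in\mathbb{Z}^{+}$ and $t_i$ an integer with $0\leq t_i\leq p-1$ for $1\leq i\leq 3$. Then the quotient $\frac{\langle A\rangle}{p}$ is given as follows. For $p=2$: - if $(t_1,t_2,t_3)=(0,0,1)$, then $\frac{\langle A\rangle}{2}=\left\langle \frac{a_1}{2},\frac{a_2}{2},a_3\right\rangle$; - if $(t_1,t_2,t_3)=(0,1,1)$, then $\frac{\langle A\rangle}{2}=\left\langle \frac{a_1}{2},a_2,a_3,\frac{a_2+a_3}{2}\right\rangle$; - if $(t_1,t_2,t_3)=(1,1,1)$, then $\frac{\langle A\rangle}{2}=\left\langle a_1,a_2,a_3,\frac{a_1+a_2}{2},\frac{a_1+a_3}{2},\frac{a_2+a_3}{2}\right\rangle$. For $p=3$: - if $(t_1,t_2,t_3)=(0,0,1)$ or $(0,0,2)$, then $\frac{\langle A\rangle}{3}=\left\langle \frac{a_1}{3},\frac{a_2}{3},a_3\right\rangle$; - if $(t_1,t_2,t_3)=(0,1,1)$ or $(0,2,2)$, then $\frac{\langle A\rangle}{3}=\left\langle \frac{a_1}{3},a_2,a_3,\frac{2a_2+a_3}{3},\frac{a_2+2a_3}{3}\right\rangle$; - if $(t_1,t_2,t_3)=(0,1,2)$, then $\frac{\langle A\rangle}{3}=\left\langle \frac{a_1}{3},a_2,a_3,\frac{a_2+a_3}{3}\right\rangle$; - if $(t_1,t_2,t_3)=(1,1,1)$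 or $(2,2,2)$, then $\frac{\langle A\rangle}{3}=\left\langle a_1,a_2,a_3,\frac{2a_1+a_2}{3},\frac{2a_1+a_3}{3},\frac{2a_2+a_1}{3},\frac{2a_2+a_3}{3},\frac{2a_3+a_1}{3},\frac{2a_3+a_2}{3},\frac{a_1+a_2+a_3}{3}\right\rangle$; - if $(t_1,t_2,t_3)=(1,1,2)$, then $\frac{\langle A\rangle}{3}=\left\langle a_1,a_2,a_3,\frac{a_1+a_3}{3},\frac{a_2+a_3}{3},\frac{2a_1+a_2}{3},\frac{2a_2+a_1}{3}\right\rangle$; - if $(t_1,t_2,t_3)=(1,2,2)$, then $\frac{\langle A\rangle}{3}=\left\langle a_1,a_2,a_3,\frac{a_1+a_2}{3},\frac{a_1+a_3}{3},\frac{2a_2+a_3}{3},\frac{2a_3+a_2}{3}\right\rangle$.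
   Context: $\mathbb{N}$ denotes the non-negative integers and $\mathbb{Z}^{+}$ the positive integers. For positive integers $b_1,\ldots,b_m$, $\langle b_1,\ldots,b_m\rangle=\{x_1b_1+\cdots+x_mb_m\mid x_i\in\mathbb{N}\}$ is the submonoid of $(\mathbb{N},+)$ they generate, and for $A=(a_1,a_2,a_3)$ we write $\langle A\rangle=\langle a_1,a_2,a_3\rangle$. The quotient of $\langle A\rangle$ by $p\in\mathbb{Z}^+$ is $\frac{\langle A\rangle}{p}=\{m\in\mathbb{N}\mid pm\in\langle A\rangle\}$. *)

(* Defs.v *)
From mathcomp Require Import all_boot.
From mathcomp Require Import boolp classical_sets.

Set Implicit Arguments.
Unset Strict Implicit.
Unset Printing Implicit Defensive.

Local Open Scope classical_set_scope.

(* The submonoid <b_1, ..., b_m> of (nat, +), for b = [:: b_1; ...; b_m]. *)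
Definition gen_submonoid (b : seq nat) : set nat :=
  [set n | exists x : 'I_(size b) -> nat,
     n = \sum_(i < size b) x i * nth 0 b i].

Definition quotient (S : set nat) (p : nat) : set nat :=
  [set m | S (p * m)].

(* Main.v *)
(** The element of the quotient defined by [p * m = x1 a1 + x2 a2 + x3 a3] only
    depends on the vector [x], which ranges over the vectors of [N^3] with
    [p %| x . t].  These form a monoid closed under subtraction, so a set [C] of
    such vectors generates it as soon as every nonzero vector of the monoid
    dominates a nonzero vector of [C].  Since [p e_i] belongs to the monoid,
    this only has to be tested on the box [0, p]^3, which is a finite
    computation for each residue vector [t]. *)
Require Import Defs.
From mathcomp Require Import all_boot zify ring.
From mathcomp Require Import boolp classical_sets.

Set Implicit Arguments.
Unset Strict Implicit.
Unset Printing Implicit Defensive.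

Lemma gen_submonoid0 b : gen_submonoid b 0.
Proof. by exists (fun=> 0); rewrite big1 // => i _; rewrite mul0n. Qed.

Lemma gen_submonoidD b m n :
  gen_submonoid b m -> gen_submonoid b n -> gen_submonoid b (m + n).
Proof.
move=> [x ->] [y ->]; exists (fun i => x i + y i).
by rewrite -big_split /=; apply: eq_bigr => i _; rewrite mulnDl.
Qed.

Lemma gen_submonoidM b k n : gen_submonoid b n -> gen_submonoid b (k * n).
Proof.
move=> [x ->]; exists (fun i => k * x i).
by rewrite big_distrr /=; apply: eq_bigr => i _; rewrite mulnA.
Qed.

Lemma mem_gen_submonoid b n : n \in b -> gen_submonoid b n.
Proof.
move=> bn; have ltb : index n b < size b by rewrite index_mem.
exists (fun i => (i == Ordinal ltb) : nat).
rewrite (bigD1 (Ordinal ltb)) //= eqxx mul1n nth_index // big1 ?addn0 //.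
by move=> i /negPf ->.
Qed.

Lemma gen_submonoid_ind b (P : nat -> Prop) :
    P 0 -> (forall m n, P m -> P n -> P (m + n)) -> {in b, forall n, P n} ->
  forall n, gen_submonoid b n -> P n.
Proof.
move=> P0 PD Pb n [x ->]; apply: (big_ind P) => // i _.
elim: (x i) => [|k IHk] //; rewrite mulSn; apply: PD => //.
exact/Pb/mem_nth.
Qed.

Definition dot3 (x y : nat * nat * nat) :=
  x.1.1 * y.1.1 + x.1.2 * y.1.2 + x.2 * y.2.

Definition le3 (x y : nat * nat * nat) :=
  [&& x.1.1 <= y.1.1, x.1.2 <= y.1.2 & x.2 <= y.2].

Lemma gen_submonoid3P a n :
  gen_submonoid [:: a.1.1; a.1.2; a.2] n <-> exists x, n = dot3 x a.
Proof.
split=> [[x ->]|[x ->]].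
  exists (x ord0, x (lift ord0 ord0), x (lift ord0 (lift ord0 ord0))).
  by rewrite !big_ord_recl big_ord0 addn0 addnA.
by do 2?apply: gen_submonoidD; apply: gen_submonoidM; apply: mem_gen_submonoid;
  rewrite !inE eqxx ?orbT.
Qed.

(** A boolean certificate, so that evaluation settles it for concrete [p], [t] and [C]. The first
    conjunct also keeps the zero vector out of [C], so that subtracting an element of [C] is a
    strict descent. The ranges include [p] itself, so that the vectors [p e_i] lie in the box. *)
Definition generates_mod p t C :=
  all (fun c => (c != (0, 0, 0)) && (p %| dot3 c t)) C &&
  all (fun x => (x != (0, 0, 0)) && (p %| dot3 x t) ==> has (le3^~ x) C)
    [seq (ij, k) | ij <- [seq (i, j) | i <- iota 0 p.+1, j <- iota 0 p.+1],
                   k <- iota 0 p.+1].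

(** Either all coordinates of [x] are below [p] and [x] lies in the box, or some coordinate is at
    least [p] and [x] dominates the box vector [p e_i]; in the latter case domination by
    transitivity suffices. *)
Lemma dominates_generator p t C x : 0 < p -> generates_mod p t C ->
  x != (0, 0, 0) -> p %| dot3 x t -> exists2 c, c \in C & le3 c x.
Proof.
move=> p_gt0 /andP[_ /allP gen]; case: x => [[x1 x2] x3] x_neq0 px.
have box y : le3 y (p, p, p) -> y != (0, 0, 0) -> p %| dot3 y t ->
    exists2 c, c \in C & le3 c y.
  case: y => [[y1 y2] y3] /and3P[/= y1p y2p y3p] y0 py; apply/hasP.
  apply: (implyP (gen _ _)); last by rewrite y0.
  apply/allpairsP; exists ((y1, y2), y3); rewrite mem_iota ltnS; split=> //.
  by apply/allpairsP; exists (y1, y2); rewrite !mem_iota !ltnS.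
have corner y : le3 y (p, p, p) -> y != (0, 0, 0) -> p %| dot3 y t ->
    le3 y (x1, x2, x3) -> exists2 c, c \in C & le3 c (x1, x2, x3).
  move=> yp y0 py /and3P[l1 l2 l3]; have [c Cc /and3P[m1 m2 m3]] := box y yp y0 py.
  exists c => //; apply/and3P.
  by split; [apply: leq_trans l1 | apply: leq_trans l2 | apply: leq_trans l3].
have p_neq0 : p != 0 by rewrite -lt0n.
have [p_le1|lt1] := leqP p x1.
  apply: (corner (p, 0, 0)); rewrite /le3 /dot3 ?xpair_eqE /= ?leqnn ?(negPf p_neq0) //.
    by rewrite !mul0n !addn0 dvdn_mulr.
  by rewrite p_le1.
have [p_le2|lt2] := leqP p x2.
  apply: (corner (0, p, 0)); rewrite /le3 /dot3 ?xpair_eqE /= ?leqnn ?(negPf p_neq0) //.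
    by rewrite !mul0n addn0 dvdn_mulr.
  by rewrite p_le2.
have [p_le3|lt3] := leqP p x3.
  apply: (corner (0, 0, p)); rewrite /le3 /dot3 ?xpair_eqE /= ?leqnn ?(negPf p_neq0) //.
  by rewrite !mul0n dvdn_mulr.
by apply: box => //; apply/and3P; split; apply: ltnW.
Qed.

Lemma quotient_gen_submonoid p k t a C : 0 < p ->
    a = (p * k.1.1 + t.1.1, p * k.1.2 + t.1.2, p * k.2 + t.2) ->
    generates_mod p t C ->
  quotient (gen_submonoid [:: a.1.1; a.1.2; a.2]) p =
  gen_submonoid [seq dot3 c a %/ p | c <- C].
Proof.
move=> p_gt0 def_a gen.
(* Since [a] and [t] are congruent mod [p], the condition on [x] depends on the residues only. *)
have dvd_at x : (p %| dot3 x a) = (p %| dot3 x t).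
  have -> : dot3 x a = p * dot3 x k + dot3 x t by rewrite def_a /dot3 /=; ring.
  by rewrite dvdn_addr ?dvdn_mulr.
apply/seteqP; split=> m; rewrite /quotient /=.
  case/gen_submonoid3P=> x def_pm.
  have pxa : p %| dot3 x a by rewrite -def_pm dvdn_mulr.
  have -> : m = dot3 x a %/ p by rewrite -def_pm mulKn.
  (* Descent on the coordinate sum of [x]: split off a dominated [c] from [C] and continue with
     [x - c]. *)
  have [n] := ubnP (x.1.1 + x.1.2 + x.2).
  elim: n x pxa {m def_pm} => // n IHn x pxa lexn.
  have [->|x_neq0] := eqVneq x (0, 0, 0).
    by rewrite /dot3 /= !mul0n div0n; apply: gen_submonoid0.
  have [|c Cc cx] := dominates_generator p_gt0 gen x_neq0; first by rewrite -dvd_at.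
  have /andP[/allP/(_ c Cc)/andP[c_neq0 pct] _] := gen.
  have pca : p %| dot3 c a by rewrite dvd_at.
  (* These truncated subtractions are exact because [c] is dominated by [x]. *)
  pose y := (x.1.1 - c.1.1, x.1.2 - c.1.2, x.2 - c.2).
  have def_x : dot3 x a = dot3 c a + dot3 y a.
    case/and3P: cx => l1 l2 l3; rewrite /dot3 /= -[in LHS](subnKC l1).
    by rewrite -[in LHS](subnKC l2) -[in LHS](subnKC l3); ring.
  rewrite def_x divnDl //; apply: gen_submonoidD.
    exact/mem_gen_submonoid/map_f.
  apply: IHn; first by rewrite -(dvdn_addr _ pca) -def_x.
  move: cx c_neq0 lexn; rewrite /y; case: (c) (x) => [[? ?] ?] [[? ?] ?].
  by rewrite /le3 !xpair_eqE /=; lia.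
(* Conversely, the quotient is itself a submonoid, so it is enough that it contains each
   generator. *)
apply: (gen_submonoid_ind (P := fun m => gen_submonoid _ (p * m))).
- by rewrite muln0; apply: gen_submonoid0.
- by move=> u v Su Sv; rewrite mulnDr; apply: gen_submonoidD.
- move=> _ /mapP[c Cc ->]; apply/gen_submonoid3P; exists c.
  have /andP[/allP/(_ c Cc)/andP[_ pct] _] := gen.
  by rewrite mulnC divnK // dvd_at.
Qed.

Theorem mainTheorem2 (p a1 a2 a3 k1 k2 k3 t1 t2 t3 : nat)
  (hp : p = 2 \/ p = 3)
  (hgcd : gcdn (gcdn a1 a2) a3 = 1)
  (ha1 : a1 = p * k1 + t1) (ha2 : a2 = p * k2 + t2) (ha3 : a3 = p * k3 + t3)
  (hk1 : 0 < k1) (hk2 : 0 < k2) (hk3 : 0 < k3)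
  (ht1 : t1 <= p - 1) (ht2 : t2 <= p - 1) (ht3 : t3 <= p - 1) :
  (p = 2 ->
    ((t1, t2, t3) = (0, 0, 1) ->
       quotient (gen_submonoid [:: a1; a2; a3]) p =
       gen_submonoid [:: a1 %/ 2; a2 %/ 2; a3]) /\
    ((t1, t2, t3) = (0, 1, 1) ->
       quotient (gen_submonoid [:: a1; a2; a3]) p =
       gen_submonoid [:: a1 %/ 2; a2; a3; (a2 + a3) %/ 2]) /\
    ((t1, t2, t3) = (1, 1, 1) ->
       quotient (gen_submonoid [:: a1; a2; a3]) p =
       gen_submonoid [:: a1; a2; a3;
         (a1 + a2) %/ 2; (a1 + a3) %/ 2; (a2 + a3) %/ 2])) /\
  (p = 3 ->
    ((t1, t2, t3) = (0, 0, 1) \/ (t1, t2, t3) = (0, 0, 2) ->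
       quotient (gen_submonoid [:: a1; a2; a3]) p =
       gen_submonoid [:: a1 %/ 3; a2 %/ 3; a3]) /\
    ((t1, t2, t3) = (0, 1, 1) \/ (t1, t2, t3) = (0, 2, 2) ->
       quotient (gen_submonoid [:: a1; a2; a3]) p =
       gen_submonoid [:: a1 %/ 3; a2; a3;
         (2 * a2 + a3) %/ 3; (a2 + 2 * a3) %/ 3]) /\
    ((t1, t2, t3) = (0, 1, 2) ->
       quotient (gen_submonoid [:: a1; a2; a3]) p =
       gen_submonoid [:: a1 %/ 3; a2; a3; (a2 + a3) %/ 3]) /\
    ((t1, t2, t3) = (1, 1, 1) \/ (t1, t2, t3) = (2, 2, 2) ->
       quotient (gen_submonoid [:: a1; a2; a3]) p =
       gen_submonoid [:: a1; a2; a3;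
         (2 * a1 + a2) %/ 3; (2 * a1 + a3) %/ 3;
         (2 * a2 + a1) %/ 3; (2 * a2 + a3) %/ 3;
         (2 * a3 + a1) %/ 3; (2 * a3 + a2) %/ 3;
         (a1 + a2 + a3) %/ 3]) /\
    ((t1, t2, t3) = (1, 1, 2) ->
       quotient (gen_submonoid [:: a1; a2; a3]) p =
       gen_submonoid [:: a1; a2; a3;
         (a1 + a3) %/ 3; (a2 + a3) %/ 3;
         (2 * a1 + a2) %/ 3; (2 * a2 + a1) %/ 3]) /\
    ((t1, t2, t3) = (1, 2, 2) ->
       quotient (gen_submonoid [:: a1; a2; a3]) p =
       gen_submonoid [:: a1; a2; a3;
         (a1 + a2) %/ 3; (a1 + a3) %/ 3;
         (2 * a2 + a3) %/ 3; (2 * a3 + a2) %/ 3])).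
Proof.
have key C : generates_mod p (t1, t2, t3) C ->
    quotient (gen_submonoid [:: a1; a2; a3]) p =
    gen_submonoid [seq dot3 c (a1, a2, a3) %/ p | c <- C].
  move=> gen; apply: (quotient_gen_submonoid (k := (k1, k2, k3)) (a := (a1, a2, a3)) _ _ gen).
    by case: hp => ->.
  by rewrite ha1 ha2 ha3.
move: key {ha1 ha2 ha3 hk1 hk2 hk3 ht1 ht2 ht3 hgcd}; case: hp => -> key;
  split=> // _.
- split; last split; case=> ? ? ?; subst t1 t2 t3.
  (* Each vector lists the coefficients of [p] times a generator: [(1, 0, 0)] encodes [a1 %/ 2] and
     [(0, 0, 2)] encodes [a3]. The certificate is checked by evaluation. The other cases follow the
     same pattern. *)
  + rewrite (key [:: (1, 0, 0); (0, 1, 0); (0, 0, 2)]) //.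
    by congr gen_submonoid; rewrite /dot3 /=; do ?congr cons; lia.
  + rewrite (key [:: (1, 0, 0); (0, 2, 0); (0, 0, 2); (0, 1, 1)]) //.
    by congr gen_submonoid; rewrite /dot3 /=; do ?congr cons; lia.
  + rewrite (key [:: (2, 0, 0); (0, 2, 0); (0, 0, 2);
                     (1, 1, 0); (1, 0, 1); (0, 1, 1)]) //.
    by congr gen_submonoid; rewrite /dot3 /=; do ?congr cons; lia.
- split; [|split; [|split; [|split; [|split]]]].
  (* The two residue vectors are opposite mod 3, hence impose the same divisibility condition and
     share one list [C]. *)
  + move=> ht; rewrite (key [:: (1, 0, 0); (0, 1, 0); (0, 0, 3)]).
      by congr gen_submonoid; rewrite /dot3 /=; do ?congr cons; lia.
    by case: ht => -[-> -> ->].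
  + move=> ht; rewrite (key [:: (1, 0, 0); (0, 3, 0); (0, 0, 3);
                                (0, 2, 1); (0, 1, 2)]).
      by congr gen_submonoid; rewrite /dot3 /=; do ?congr cons; lia.
    by case: ht => -[-> -> ->].
  + case=> ? ? ?; subst t1 t2 t3.
    rewrite (key [:: (1, 0, 0); (0, 3, 0); (0, 0, 3); (0, 1, 1)]) //.
    by congr gen_submonoid; rewrite /dot3 /=; do ?congr cons; lia.
  + move=> ht; rewrite (key [:: (3, 0, 0); (0, 3, 0); (0, 0, 3);
        (2, 1, 0); (2, 0, 1); (1, 2, 0); (0, 2, 1); (1, 0, 2); (0, 1, 2);
        (1, 1, 1)]).
      by congr gen_submonoid; rewrite /dot3 /=; do ?congr cons; lia.
    by case: ht => -[-> -> ->].
  + case=> ? ? ?; subst t1 t2 t3.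
    rewrite (key [:: (3, 0, 0); (0, 3, 0); (0, 0, 3);
                     (1, 0, 1); (0, 1, 1); (2, 1, 0); (1, 2, 0)]) //.
    by congr gen_submonoid; rewrite /dot3 /=; do ?congr cons; lia.
  (* Up to sign mod 3, this is the previous case with the first and third coordinates exchanged, and
     so is its list of vectors. *)
  + case=> ? ? ?; subst t1 t2 t3.
    rewrite (key [:: (3, 0, 0); (0, 3, 0); (0, 0, 3);
                     (1, 1, 0); (1, 0, 1); (0, 2, 1); (0, 1, 2)]) //.
    by congr gen_submonoid; rewrite /dot3 /=; do ?congr cons; lia.
Qed.
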